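(* Let $\mathcal{G}$ be a group of order $n$ with elements labelled by $[n]$ and operation $\oplus$. Let $\mathcal{S}$ be a universal cycle for $k$-permutations of $[n]$, and let $\mathcal{D}$ be a quotient string for $\ell$-permutations of $[n]$ with respect to the equivalence relation ''differing by a constant of $\mathcal{G}$''. Let $\mathcal{T}$ be the torus $\mathcal{D}\times\mathcal{S}$ over $\mathcal{G}$. Fix a block pattern $\mathcal{B}$ with $k$ blocks horizontally and $\ell$ blocks vertically (a cross). Fill $\mathcal{B}$ with elements of $\mathcal{G}$ arbitrarily such that the $k$ horizontal blocks form a $k$-permutation and the $\ell$ vertical blocks form an $\ell$-permutation. Then this filled block pattern appears exactly once in $\mathcal{T}$.
   Context: A $k$-permutation of an $n$-element set is a $k$-tuple of pairwise distinct elements of it; $[n]$ is an $n$-element set identified with the elements of $\mathcal{G}$. Universal cycle for $k$-permutations of $[n]$: a cyclic sequence over $[n]$ in which each $k$-permutation of $[n]$ appears exactly once as $k$ consecutive letters (subscripts modulo the length). Quotient string for $\ell$-permutations: consider on $\ell$-permutations the equivalence relation $x\equiv y$ iff there is $g\in\mathcal{G}$ with $x_i=g\oplus y_i$ for all $i$. A quotient string is a cyclic string over $[n]$ which, for each equivalence class, contains exactly one $\ell$-permutation of that class as a substring of $\ell$ (cyclically) consecutive letters, and contains it exactly once; that is, a universal cycle for a set of equivalence class representatives. Torus $\mathcal{D}\times\mathcal{S}$ over $\mathcal{G}$: the array with $|\mathcal{D}|$ rows and $|\mathcal{S}|$ columns whose entry in row $i$ and column $j$ is $\mathcal{S}_j\oplus\mathcal{D}_i$,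 with row and column indices read modulo $|\mathcal{D}|$ and $|\mathcal{S}|$ respectively. Block pattern with $k$ blocks horizontally and $\ell$ blocks vertically: a set of $k+\ell-1$ cells inside an $\ell\times k$ array (rows indexed $0,\ldots,\ell-1$, columns indexed $0,\ldots,k-1$) consisting of all $k$ consecutive cells of one row (the horizontal blocks) and all $\ell$ consecutive cells of one column (the vertical blocks), which overlap in exactly one cell. A filling $f$ of $\mathcal{B}$ appears in $\mathcal{T}$ at position $(i,j)$ if for each cell $(u,v)$ of $\mathcal{B}$ the entry of $\mathcal{T}$ in row $i+u$ and column $j+v$ is $f(u,v)$; ''exactly once'' means at exactly one position $(i,j)$ with $i$ modulo $|\mathcal{D}|$ and $j$ modulo $|\mathcal{S}|$. *)

(* Defs.v *)
From HB Require Import structures.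
From mathcomp Require Import all_boot all_fingroup.
Set Implicit Arguments.
Unset Strict Implicit.
Unset Printing Implicit Defensive.

Local Open Scope group_scope.

Section CyclicStrings.

Variable gT : finGroupType.

(* A cyclic string is a [seq] whose subscripts are read modulo its size. The
   default value of [nth] is reached only when the string is empty. *)
Definition letter (s : seq gT) (i : nat) : gT := nth 1 s (i %% size s)%N.

Definition window (k : nat) (s : seq gT) (i : nat) : k.-tuple gT :=
  [tuple letter s (i + u)%N | u < k].

Definition occurs (k : nat) (s : seq gT) (x : k.-tuple gT) : Prop :=
  exists i : 'I_(size s), window k s i = x.

Definition occurs_once (k : nat) (s : seq gT) (x : k.-tuple gT) : Prop :=
  exists! i : 'I_(size s), window k s i = x.

Definition kpermutation (k : nat) (x : k.-tuple gT) : bool := uniq x.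

Definition universal_cycle (k : nat) (s : seq gT) : Prop :=
  forall x : k.-tuple gT, kpermutation x -> occurs_once s x.

(* The constant multiplies on the left. *)
Definition diff_by_constant (l : nat) (x y : l.-tuple gT) : Prop :=
  exists g : gT, forall i : 'I_l, tnth x i = g * tnth y i.

(* An equivalence class is given by any of its elements [x]; [y] is the only
   element of the class of [x] which is a substring of [s]. *)
Definition quotient_string (l : nat) (s : seq gT) : Prop :=
  forall x : l.-tuple gT, kpermutation x ->
  exists y : l.-tuple gT,
    [/\ kpermutation y, diff_by_constant y x, occurs_once s y
      & forall z : l.-tuple gT,
          kpermutation z -> diff_by_constant z x -> occurs s z -> z = y].

Definition torus (D S : seq gT) (i j : nat) : gT := letter S j * letter D i.

(* A filling is a total function on the array, of which only the values on the
   cells of the pattern [B] matter. *)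
Definition appears_at (l k : nat) (B : {set 'I_l * 'I_k})
    (f : 'I_l -> 'I_k -> gT) (T : nat -> nat -> gT) (i j : nat) : Prop :=
  forall (u : 'I_l) (v : 'I_k), (u, v) \in B -> T (i + u)%N (j + v)%N = f u v.

End CyclicStrings.

(* The block pattern made of row [r] and column [c]; the existence of [r] and
   [c] forces [l] and [k] to be positive. *)
Definition cross (l k : nat) (r : 'I_l) (c : 'I_k) : {set 'I_l * 'I_k} :=
  [set uv | (uv.1 == r) || (uv.2 == c)].

(* Main.v *)
(** Dividing the vertical blocks on the left by the entry of S above the cross
    column gives the window of D at the row position, so this window is the
    unique representative in D of the class of the vertical blocks, which
    determines the row. Dividing the horizontal blocks on the right by the entry
    of D next to the cross row then gives the window of S, a k-permutation, which
    determines the column. In the column so found, the entries of D and S meet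
    correctly at the centre of the cross, hence along the whole vertical line. *)
Require Import Defs.
From HB Require Import structures.
From mathcomp Require Import all_boot all_fingroup.
Set Implicit Arguments.
Unset Strict Implicit.
Unset Printing Implicit Defensive.

Local Open Scope group_scope.

(** Along the column the factor from [S] is constant, along the row the one from [D], so each line
    is a translate of a single window. *)
Lemma appears_at_crossP (gT : finGroupType) (l k : nat) (r : 'I_l) (c : 'I_k)
    (f : 'I_l -> 'I_k -> gT) (D S : seq gT) (i j : nat) :
  appears_at (cross r c) f (torus D S) i j <->
  (forall u : 'I_l, letter S (j + c) * letter D (i + u) = f u c) /\
  (forall v : 'I_k, letter S (j + v) * letter D (i + r) = f r v).
Proof.
split=> [fT | [fD fS] u v].
  by split=> [u | v]; apply: fT; rewrite inE eqxx ?orbT.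
by rewrite inE => /orP[] /= /eqP ->; [apply: fS | apply: fD].
Qed.

Lemma windowP (gT : finGroupType) (k : nat) (s : seq gT) (i : nat)
    (x : k.-tuple gT) :
  window k s i = x <-> forall u : 'I_k, letter s (i + u) = tnth x u.
Proof.
split=> [<- u | sx]; first by rewrite tnth_mktuple.
by apply: eq_from_tnth => u; rewrite tnth_mktuple.
Qed.

Lemma kpermutation_map (gT : finGroupType) (k : nat) (x : k.-tuple gT)
    (h : gT -> gT) :
  injective h -> kpermutation (map_tuple h x) = kpermutation x.
Proof. by move=> h_inj; rewrite /kpermutation map_inj_uniq. Qed.

Theorem theorem4p4 (n k l : nat) (gT : finGroupType) (order_gT : #|gT| = n)
    (S D : seq gT)
    (S_ucycle : universal_cycle k S)
    (D_quotient : quotient_string l D)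
    (r : 'I_l) (c : 'I_k)
    (f : 'I_l -> 'I_k -> gT)
    (f_horizontal : kpermutation [tuple f r v | v < k])
    (f_vertical : kpermutation [tuple f u c | u < l]) :
  exists! p : 'I_(size D) * 'I_(size S),
    appears_at (cross r c) f (torus D S) p.1 p.2.
Proof.
have [y [_ [g yE] [i [Di i_uniq]] y_uniq]] := D_quotient _ f_vertical.
have DiE (u : 'I_l) : letter D (i + u) = g * f u c.
  by move/windowP: Di => ->; rewrite yE tnth_mktuple.
pose x := map_tuple (mulg^~ (letter D (i + r))^-1) [tuple f r v | v < k].
have x_perm : kpermutation x by rewrite kpermutation_map //; apply: mulIg.
have [j [Sj j_uniq]] := S_ucycle x x_perm.
have SjE (v : 'I_k) : letter S (j + v) = f r v * (letter D (i + r))^-1.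
  by move/windowP: Sj => ->; rewrite tnth_map tnth_mktuple.
exists (i, j); split=> [|[i' j'] /appears_at_crossP[/= fD fS]].
  apply/appears_at_crossP; split=> [u | v] /=; last by rewrite SjE mulgKV.
  (* The entry of [S] at the centre is [f r c * (g * f r c)^-1 = g^-1], which cancels the [g] of
     [DiE] for every [u]. *)
  by rewrite SjE !DiE invMg mulKVg mulKg.
have Di'E (u : 'I_l) : letter D (i' + u) = (letter S (j' + c))^-1 * f u c.
  by rewrite -fD mulKg.
pose z := map_tuple (mulg (letter S (j' + c))^-1) [tuple f u c | u < l].
have Di' : window l D i' = z.
  by apply/windowP => u; rewrite tnth_map tnth_mktuple.
(* The constant in [z] depends on the unknown [j'], but [D] contains only one translate of the
   vertical blocks. *)
have zy : z = y.
  apply: y_uniq; last by exists i'.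
    by rewrite kpermutation_map //; apply: mulgI.
  by exists (letter S (j' + c))^-1 => u; rewrite tnth_map.
have ii' : i = i' by apply: i_uniq; rewrite Di'.
congr (_, _) => //; apply: j_uniq; apply/windowP => v.
by rewrite tnth_map tnth_mktuple -fS ii' mulgK.
Qed.
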